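(* Let $p:\mathbb{C}\to\mathbb{C}$ be a polynomial of degree four with four distinct zeros forming a concave quadrilateral; that is, the zeros can be named $z_1,z_2,z_3,z_4$ so that $z_1$ lies in the convex hull of $z_2,z_3,z_4$ and subdivides this triangular convex hull into the three non-degenerate triangles with vertex sets $\{z_1,z_2,z_3\}$, $\{z_1,z_3,z_4\}$, $\{z_1,z_4,z_2\}$. Then the interior of at least one of these three triangles does not contain a zero of the derivative $p'$.
   Context: $\mathbb{C}$ is identified with the Euclidean plane $\mathbb{R}^2$. A triangle means the convex hull of its three vertices; it is non-degenerate if the vertices are not collinear. The interior of a triangle is its topological interior in the plane. *)

(* Defs.v *)
From HB Require Import structures.
From mathcomp Require Import all_boot all_order all_algebra.
From mathcomp Require Import all_classical all_reals all_analysis.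
From mathcomp Require Import complex.

Set Implicit Arguments.
Unset Strict Implicit.
Unset Printing Implicit Defensive.

Import Order.TTheory GRing.Theory Num.Theory.
Import numFieldNormedType.Exports.

Local Open Scope classical_set_scope.
Local Open Scope ring_scope.
Local Open Scope complex_scope.

(* [Rcomplex R] is [R[i]] seen as a vector space over [R], which makes the
   weights of convex combinations real; [R[i]] itself is an [R[i]]-module. *)
Definition convex_hull (R : realType) (A : set R[i]) : set R[i] :=
  smallest (@convex_set R (Rcomplex R)) A.

Definition triangle (R : realType) (a b c : R[i]) : set R[i] :=
  convex_hull [set a; b; c].

Definition collinear (R : realType) (a b c : R[i]) : Prop :=
  exists o d : R[i],
    d != 0 /\ [set a; b; c] `<=` [set o + t%:C * d | t in [set: R]].

Definition nondegenerate (R : realType) (a b c : R[i]) : Prop :=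
  ~ collinear a b c.

(* The topology is the one given by the modulus on the numFieldType [R[i]],
   i.e., the Euclidean topology of the plane. It is carried by the type alias
   [R[i]^o]; balls have radii that are positive in [R[i]], hence real. *)
Definition plane_interior (R : realType) (A : set R[i]) : set R[i] :=
  interior (A : set R[i]^o).

(* The inner vertex is [z1]. A point of a triangle always cuts it into the
   three triangles below, so that only their non-degeneracy is a condition. *)
Definition concave_quadrilateral (R : realType) (z1 z2 z3 z4 : R[i]) : Prop :=
  triangle z2 z3 z4 z1 /\
  [/\ nondegenerate z1 z2 z3, nondegenerate z1 z3 z4 & nondegenerate z1 z4 z2].

(* Main.v *)
Require Import Defs.
From HB Require Import structures.
From mathcomp Require Import all_boot all_order all_algebra.
From mathcomp Require Import all_classical all_reals all_analysis.
From mathcomp Require Import complex.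
From mathcomp Require Import ring lra.

Import Order.TTheory GRing.Theory Num.Theory.
Local Open Scope classical_set_scope.
Local Open Scope ring_scope.
Local Open Scope complex_scope.

(** The proof compares arguments of complex numbers. Translate so that the
    inner zero is the origin, and let [a], [b], [c] be the other three zeros,
    in counterclockwise order. If [L] is the leading coefficient of [p], the
    value of [p'] at the origin is [- L * (a * b * c)]; if [p'] has three
    distinct roots [w1], [w2], [w3], it is also [- 4 * L * (w1 * w2 * w3)].
    Hence [a * b * c = 4 * (w1 * w2 * w3)].

    Suppose that each of the three triangles contains a critical point in its
    interior. The interiors lie in the open cones spanned by [a, b], by [b, c]
    and by [c, a], so the critical points are distinct and

      [arg a < arg w1 < arg b < arg w2 < arg c < arg w3 < arg a + 2 * pi].

    Adding up, [arg w1 + arg w2 + arg w3] lies strictly between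
    [arg a + arg b + arg c] and the same sum plus [2 * pi], so the products
    [a * b * c] and [w1 * w2 * w3] cannot differ by a positive factor. This is
    [mul_neq_in_cyclic_cones]; it contradicts [deriv_roots_prod].

    Arguments themselves are avoided. The angles between consecutive vectors
    are less than [pi], so they are described by numbers in the upper half
    plane, such as [conjc a * w1] for the angle from [a] to [w1], and compared
    through their cotangents. Two such angles add up to more than [pi] exactly
    when the sum of their cotangents is negative, which turns the
    contradiction into a linear one ([no_upper_half_plane_square]).

    That the origin is inside the triangle [a b c] serves to show that the
    three consecutive angles have the same orientation ([same_orientation]);
    the clockwise case follows by exchanging two vertices. *)

(** * Oriented angles between plane vectors *)

Definition cross {R : rcfType} (z w : R[i]) : R := complex.Im (conjc z * w).

Lemma crossE {R : rcfType} (z w : R[i]) :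
  cross z w = complex.Re z * complex.Im w - complex.Im z * complex.Re w.
Proof. by case: z w => [a b] [c d]; rewrite /cross; simpc => /=; ring. Qed.

Lemma crossC {R : rcfType} (z w : R[i]) : cross z w = - cross w z.
Proof. by rewrite !crossE; ring. Qed.

Lemma crosszz {R : rcfType} (z : R[i]) : cross z z = 0.
Proof. by rewrite crossE; ring. Qed.

Lemma cross_neq0 {R : rcfType} (z w : R[i]) :
  cross z w != 0 -> (z != 0) && (w != 0).
Proof.
by move=> h; apply/andP; split; apply: contraNneq h => ->;
  rewrite crossE /= ?(mul0r, mulr0) subrr.
Qed.

Lemma mul_conj_gt0 {R : rcfType} (z : R[i]) : z != 0 -> 0 < conjc z * z.
Proof.
case: z => x y z0; have : 0 < x ^+ 2 + y ^+ 2.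
  rewrite lt_def addr_ge0 ?sqr_ge0 // andbT paddr_eq0 ?sqr_ge0 // !sqrf_eq0.
  by move: z0; rewrite eq_complex.
rewrite ltcE; simpc => /= h; apply/andP; split; first by apply/eqP; ring.
by rewrite !expr2 in h.
Qed.

(** * Angles adding up to a full turn *)

(** The angle from [a] to [w] followed by the angle from [w] to [b] is the
    angle from [a] to [b]: the two factors [w] and [conjc w] only contribute
    a positive scalar. *)
Lemma Im_mul_conj {R : rcfType} (a w b : R[i]) : w != 0 ->
  0 < cross a b -> 0 < complex.Im ((conjc a * w) * (conjc w * b)).
Proof.
move=> /mul_conj_gt0 w0 hab.
have -> : (conjc a * w) * (conjc w * b) = (conjc w * w) * (conjc a * b) by ring.
move: w0; rewrite ltcE => /andP[/eqP h0 h1].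
move: (conjc w * w) h0 h1 => [x y] /= -> hx.
move: hab; rewrite /cross; case: (conjc a * b) => s t /= ht.
by rewrite mul0r addr0 mulr_gt0.
Qed.

(** A positive product has an argument that is a multiple of [2 * pi]; the
    argument of [u * v] is therefore opposite to that of [x]. For [u] and [v]
    in the upper half plane too, the three angles add up to a full turn and
    the first two exceed a half turn. *)
Lemma Im_mul_lt0_of_mul_gt0 {R : rcfType} (u v x : R[i]) :
  0 < complex.Im x -> 0 < u * v * x -> complex.Im (u * v) < 0.
Proof.
move: (u * v) => [s1 s2]; case: x => [x1 x2]; rewrite ltcE; simpc => /= hx.
move=> /andP[/eqP h0 h1]; rewrite ltNge; apply/negP => hs.
have : (s1 * x1 - s2 * x2) * x2 > 0 by exact: mulr_gt0.
have -> : (s1 * x1 - s2 * x2) * x2 = - (s2 * (x1 ^+ 2 + x2 ^+ 2)).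
  transitivity ((s1 * x2 + s2 * x1) * x1 - s2 * (x1 ^+ 2 + x2 ^+ 2)).
    by ring.
  by rewrite h0; ring.
by rewrite oppr_gt0 ltNge mulr_ge0 // addr_ge0 ?sqr_ge0.
Qed.

(** The quotient of real by imaginary part is the cotangent of the argument;
    the sign of [Im (u * v)], which tells whether the two angles add up to
    less than [pi], is thus read off a sum of cotangents. *)
Lemma Im_mul_cot {R : rcfType} (u v : R[i]) :
  0 < complex.Im u -> 0 < complex.Im v ->
  complex.Im (u * v) / (complex.Im u * complex.Im v) =
  complex.Re u / complex.Im u + complex.Re v / complex.Im v.
Proof.
case: u v => [u1 u2] [v1 v2]; simpc => /= hu hv.
by field; rewrite !gt_eqF.
Qed.

(** The four angles would have a sum above [2 * pi] when grouped as [u, v] and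
    [u', v'], and below [2 * pi] when grouped as [u, u'] and [v, v']. In terms
    of cotangents the same total would be both negative and positive. *)
Lemma no_upper_half_plane_square {R : rcfType} (u v u' v' : R[i]) :
  0 < complex.Im u -> 0 < complex.Im v ->
  0 < complex.Im u' -> 0 < complex.Im v' ->
  complex.Im (u * v) < 0 -> complex.Im (u' * v') < 0 ->
  0 < complex.Im (u * u') -> 0 < complex.Im (v * v') -> False.
Proof.
move=> hu hv hu' hv' huv hu'v' huu' hvv'.
have := Im_mul_cot u v hu hv; have := Im_mul_cot u' v' hu' hv'.
have := Im_mul_cot u u' hu hu'; have := Im_mul_cot v v' hv hv'.
have p1 := mulr_gt0 hu hv; have p2 := mulr_gt0 hu' hv'.
have p3 := mulr_gt0 hu hu'; have p4 := mulr_gt0 hv hv'.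
have q3 := divr_gt0 huu' p3; have q4 := divr_gt0 hvv' p4.
have q1 : complex.Im (u * v) / (complex.Im u * complex.Im v) < 0.
  by rewrite pmulr_llt0 // invr_gt0.
have q2 : complex.Im (u' * v') / (complex.Im u' * complex.Im v') < 0.
  by rewrite pmulr_llt0 // invr_gt0.
lra.
Qed.

(** If the products agreed up to [rho], the angles from [a] to [w1], [b] to
    [w2] and [c] to [w3] would add up to a full turn, and so would those from
    [w1] to [b], [w2] to [c] and [w3] to [a]. By [Im_mul_lt0_of_mul_gt0] the
    first two angles of each family exceed a half turn together, although the
    angle from [a] to [b] and the one from [b] to [c] are each less than a half
    turn. *)
Lemma mul_neq_in_cyclic_cones {R : rcfType} (a b c w1 w2 w3 rho : R[i]) :
  0 < cross a b -> 0 < cross b c ->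
  0 < cross a w1 -> 0 < cross w1 b ->
  0 < cross b w2 -> 0 < cross w2 c ->
  0 < cross c w3 -> 0 < cross w3 a ->
  0 < rho -> a * b * c <> rho * (w1 * w2 * w3).
Proof.
move=> ab bc aw1 w1b bw2 w2c cw3 w3a rho0 prod_eq.
have /andP[_ w1n0] := cross_neq0 _ _ (lt0r_neq0 aw1).
have /andP[_ w2n0] := cross_neq0 _ _ (lt0r_neq0 bw2).
have /andP[_ w3n0] := cross_neq0 _ _ (lt0r_neq0 cw3).
have Wn0 : w1 * w2 * w3 != 0 by rewrite !mulf_neq0.
have pos : 0 < rho * (conjc (w1 * w2 * w3) * (w1 * w2 * w3)).
  by rewrite mulr_gt0 ?mul_conj_gt0.
have rhoJ : conjc rho = rho.
  by move: rho0; case: (rho) => r1 r2;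
    rewrite ltcE /= => /andP[/eqP-> _]; rewrite oppr0.
apply: (no_upper_half_plane_square (conjc a * w1) (conjc b * w2)
  (conjc w1 * b) (conjc w2 * c)) => //.
- apply: (Im_mul_lt0_of_mul_gt0 _ _ (conjc c * w3)) => //.
  have -> : conjc a * w1 * (conjc b * w2) * (conjc c * w3) =
      conjc (a * b * c) * (w1 * w2 * w3).
    by rewrite !rmorphM /=; ring.
  have conj_prod : conjc (rho * (w1 * w2 * w3)) = rho * conjc (w1 * w2 * w3).
    by rewrite -[in RHS]rhoJ -rmorphM.
  by rewrite prod_eq conj_prod -mulrA.
- apply: (Im_mul_lt0_of_mul_gt0 _ _ (conjc w3 * a)) => //.
  have -> : conjc w1 * b * (conjc w2 * c) * (conjc w3 * a) =
      conjc (w1 * w2 * w3) * (a * b * c).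
    by rewrite !rmorphM /=; ring.
  by rewrite prod_eq mulrCA.
- exact: Im_mul_conj.
- exact: Im_mul_conj.
Qed.

(** * Triangles, half planes and cones *)

Lemma convCE {R : realType} (l : {i01 R}) (x y : R[i]) :
  @conv R (convex_lmodType (Rcomplex R)) l x y =
  (l%:num)%:C * x + (1 - l%:num)%:C * y.
Proof.
rewrite /conv /= /unstable.onem; case: x y => [x1 x2] [y1 y2].
by simpc.
Qed.

Lemma convex_half_plane {R : realType} (u o : R[i]) :
  @convex_set R (Rcomplex R) [set z : R[i] | 0 <= cross u (z - o)].
Proof.
move=> x y l; rewrite !inE /= => hx hy.
have l0 : 0 <= l%:num by [].
have l1 : 0 <= 1 - l%:num by rewrite subr_ge0.
have -> : cross u (conv l x y - o) =
    l%:num * cross u (x - o) + (1 - l%:num) * cross u (y - o).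
  rewrite convCE; move: (l%:num) u o x y {l0 l1 hx hy} => k.
  move=> [u1 u2] [m1 m2] [x1 x2] [y1 y2].
  by rewrite !crossE /=; ring.
by rewrite addr_ge0 // mulr_ge0.
Qed.

(** From an interior point one can move a little in the direction [- 'i * u],
    across the boundary line, and stay in [A]; so the point was not on the
    line. *)
Lemma interior_half_plane {R : realType} (A : set R[i]) (u o w : R[i]) :
  u != 0 -> A `<=` [set z | 0 <= cross u (z - o)] ->
  plane_interior A w -> 0 < cross u (w - o).
Proof.
move=> u0 sub; rewrite /plane_interior /interior /= => /nbhs_ballP[e /= e0 he].
(* This step length makes [d * ('i * u)] of modulus [e / 2]. *)
pose d := e / 2 / `|u|.
have n0 : 0 < `|u| by rewrite normr_gt0.
have d0 : 0 < d by rewrite !divr_gt0.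
have wd : ball (w : R[i]^o) e (w - d * ('i * u)).
  rewrite -ball_normE /= opprB addrC subrK normrM (gtr0_norm d0) normrM.
  have -> : `|'i%C : R[i]| = 1.
    by rewrite normc_def /= expr0n add0r expr1n sqrtr1.
  by rewrite mul1r /d divfK ?gt_eqF // ltr_pdivrMr // ltr_pMr // ltr1n.
have := sub _ (he _ wd); rewrite /=.
have : 0 < conjc u * u by exact: mul_conj_gt0.
move: d0; rewrite !ltcE; move: {wd} d => [d1 d2] /= /andP[/eqP-> h1].
move: u w o {u0 sub he n0} => [u1 u2] [w1 w2] [m1 m2].
rewrite !crossE; simpc => /=.
move=> /andP[_ h2] h; have := mulr_gt0 h1 h2; nra.
Qed.

(** The two sides that meet in [o] bound half planes that contain the triangle;
    the interior lies in the open cone that they cut out. *)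
Lemma interior_triangle {R : realType} (o x y w : R[i]) :
  0 < cross (x - o) (y - o) -> plane_interior (triangle o x y) w ->
  0 < cross (x - o) (w - o) /\ 0 < cross (w - o) (y - o).
Proof.
move=> xy wi; have /andP[x0 y0] := cross_neq0 _ _ (lt0r_neq0 xy).
have half u : u != 0 -> 0 <= cross u (x - o) -> 0 <= cross u (y - o) ->
    0 < cross u (w - o).
  move=> u0 hx hy; apply: (interior_half_plane _ _ _ _ u0 _ wi).
  apply: smallest_sub; first exact: convex_half_plane.
  by move=> z /= [[->|->]|->] //; rewrite subrr crossE /= !mulr0 subrr.
split; first by apply: half => //; [rewrite crosszz | exact: ltW].
rewrite (_ : cross _ _ = cross (- (y - o)) (w - o)); last first.
  by rewrite !crossE !raddfN /=; ring.
apply: half; first by rewrite oppr_eq0.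
- rewrite (_ : cross _ _ = cross (x - o) (y - o)) ?ltW //.
  by rewrite !crossE !raddfN /=; ring.
- by rewrite (_ : cross _ _ = 0) // !crossE !raddfN /=; ring.
Qed.

Lemma triangleAC {R : realType} (a b c : R[i]) :
  triangle a b c = triangle a c b.
Proof. by rewrite /triangle setUAC. Qed.

Lemma triangle_weights {R : realType} (a b c z : R[i]) : triangle a b c z ->
  exists s t r : R, [/\ 0 <= s, 0 <= t, 0 <= r, s + t + r = 1 &
    z = s%:C * a + t%:C * b + r%:C * c].
Proof.
move: z; apply: smallest_sub => [x y l|].
  rewrite !inE => -[s [t [r [s0 t0 r0 h ->]]]].
  move=> [s' [t' [r' [s'0 t'0 r'0 h' ->]]]].
  have l0 : 0 <= l%:num by [].
  have l1 : 0 <= 1 - l%:num by rewrite subr_ge0.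
  exists (l%:num * s + (1 - l%:num) * s'), (l%:num * t + (1 - l%:num) * t'),
    (l%:num * r + (1 - l%:num) * r'); split.
  - by rewrite addr_ge0 ?mulr_ge0.
  - by rewrite addr_ge0 ?mulr_ge0.
  - by rewrite addr_ge0 ?mulr_ge0.
  - transitivity (l%:num * (s + t + r) + (1 - l%:num) * (s' + t' + r')).
      by ring.
    by rewrite h h'; ring.
  by rewrite convCE !raddfD /= !rmorphM /=; ring.
move=> z /= [[->|->]|->]; [exists 1, 0, 0|exists 0, 1, 0|exists 0, 0, 1];
  by split; rewrite ?ler01 ?lexx ?mul0r ?mul1r ?addr0 ?add0r.
Qed.

Lemma nondegenerate_cross {R : realType} (o x y : R[i]) : x != o ->
  Defs.nondegenerate o x y -> cross (x - o) (y - o) != 0.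
Proof.
move=> xo; apply: contra_not_neq => h; exists o, (x - o).
have d0 : x - o != 0 by rewrite subr_eq0.
split=> //; move=> z /= [[->|->]|->].
- by exists 0 => //; rewrite mul0r addr0.
- by exists 1 => //; rewrite mul1r addrC subrK.
set d := x - o in h d0 *; set v := y - o in h.
have real_of (k : R[i]) : complex.Im k = 0 -> k = (complex.Re k)%:C.
  by case: k => k1 k2 /= ->.
have dd := mul_conj_gt0 _ d0.
have nE : conjc d * d = (complex.Re (conjc d * d))%:C.
  by apply: real_of; move: dd; rewrite ltcE => /andP[/eqP].
have vE := real_of _ h.
exists (complex.Re (conjc d * v) / complex.Re (conjc d * d)) => //.
rewrite rmorphM fmorphV /= -vE -nE.
have -> : conjc d * v / (conjc d * d) * d = v.
  by field; move: (lt0r_neq0 dd); rewrite mulf_eq0 negb_or andbC.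
by rewrite /v addrC subrK.
Qed.

(** With [a], [b], [c] the vectors from [z1] to the three vertices, a convex
    combination [s a + t b + r c] vanishes. Taking cross products with [a],
    [b] and [c] shows that the signed areas [cross b c], [cross c a] and
    [cross a b] are proportional to [s], [t] and [r]; as the areas are nonzero,
    no weight vanishes. *)
Lemma same_orientation {R : realType} (z1 z2 z3 z4 : R[i]) :
  triangle z2 z3 z4 z1 ->
  cross (z2 - z1) (z3 - z1) != 0 -> cross (z3 - z1) (z4 - z1) != 0 ->
  cross (z4 - z1) (z2 - z1) != 0 ->
  [/\ 0 < cross (z2 - z1) (z3 - z1), 0 < cross (z3 - z1) (z4 - z1)
    & 0 < cross (z4 - z1) (z2 - z1)] \/
  [/\ cross (z2 - z1) (z3 - z1) < 0, cross (z3 - z1) (z4 - z1) < 0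
    & cross (z4 - z1) (z2 - z1) < 0].
Proof.
move=> /triangle_weights[s [t [r [s0 t0 r0 str1 z1E]]]].
set a := z2 - z1; set b := z3 - z1; set c := z4 - z1 => ab bc ca.
have combo : s%:C * a + t%:C * b + r%:C * c = 0.
  transitivity (s%:C * z2 + t%:C * z3 + r%:C * z4 - (s + t + r)%:C * z1).
    by rewrite /a /b /c !raddfD /=; ring.
  by rewrite -z1E str1 mul1r subrr.
have cross_combo (d : R[i]) : s * cross d a + t * cross d b + r * cross d c = 0.
  transitivity (cross d (s%:C * a + t%:C * b + r%:C * c)).
    rewrite !crossE.
    by case: a b c d {ab bc ca combo} => [? ?] [? ?] [? ?] [? ?] /=; ring.
  by rewrite combo crossE /= !mulr0 subrr.
have ea := cross_combo a; have eb := cross_combo b; have ec := cross_combo c.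
rewrite !crosszz (crossC a c) in ea.
rewrite !crosszz (crossC b a) in eb.
rewrite !crosszz (crossC c b) in ec.
have ab_ca : t * cross a b = r * cross c a by lra.
have bc_ab : r * cross b c = s * cross a b by lra.
have ca_bc : s * cross c a = t * cross b c by lra.
(* The weights are proportional to nonzero areas, so they vanish together. *)
have zero_l (k x y l : R) : y != 0 -> k * x = l * y -> k = 0 -> l = 0.
  by move=> y0 e k0; apply: (mulIf y0); rewrite -e k0 !mul0r.
have tn0 : t != 0.
  apply/eqP => tE; have rE := zero_l _ _ _ _ ca ab_ca tE.
  by have sE := zero_l _ _ _ _ ab bc_ab rE; lra.
have rn0 : r != 0.
  by apply: contraNneq tn0 => rE; apply/eqP/(zero_l _ _ _ _ ab (esym ab_ca) rE).
have sn0 : s != 0.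
  by apply: contraNneq tn0 => sE; apply/eqP/(zero_l _ _ _ _ bc ca_bc sE).
have tp : 0 < t by rewrite lt_def tn0.
have rp : 0 < r by rewrite lt_def rn0.
have sp : 0 < s by rewrite lt_def sn0.
have [ab0|ab0] : 0 < cross a b \/ cross a b < 0.
  by case: (ltgtP (cross a b) 0) ab => // ?; [right|left].
- left; split=> //.
  + by rewrite -(pmulr_rgt0 _ rp) bc_ab mulr_gt0.
  + by rewrite -(pmulr_rgt0 _ rp) -ab_ca mulr_gt0.
- right; split=> //.
  + by rewrite -(pmulr_rlt0 _ rp) bc_ab pmulr_rlt0.
  + by rewrite -(pmulr_rlt0 _ rp) -ab_ca pmulr_rlt0.
Qed.

(** * Critical points *)

(** Both sides are values of [p'] at [z1], up to the factor [- lead_coef p]: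
    the left one from the product rule, where only the term that
    differentiates ['X - z1] survives, the right one from the factorization of
    [p'], whose leading coefficient is [4 * lead_coef p]. *)
Lemma deriv_roots_prod {R : realType} (p : {poly R[i]})
  (z1 z2 z3 z4 w1 w2 w3 : R[i]) :
  size p = 5%N -> uniq [:: z1; z2; z3; z4] ->
  all (root p) [:: z1; z2; z3; z4] ->
  uniq [:: w1; w2; w3] -> all (root p^`()) [:: w1; w2; w3] ->
  (z2 - z1) * (z3 - z1) * (z4 - z1) = 4 * ((w1 - z1) * (w2 - z1) * (w3 - z1)).
Proof.
move=> sp uz rz uw rw.
have lp0 : lead_coef p != 0 by rewrite lead_coef_eq0 -size_poly_eq0 sp.
have pE := @all_roots_prod_XsubC _ p [:: z1; z2; z3; z4] sp rz.
rewrite uniq_rootsE in pE; move/(_ uz) in pE.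
have p3 : p^`()`_3 = lead_coef p * 4.
  by rewrite coef_deriv /lead_coef sp mulr_natr.
have sp' : size p^`() = 4%N.
  apply/eqP; rewrite eqn_leq; apply/andP; split.
    by rewrite -ltnS -sp lt_size_deriv // -size_poly_eq0 sp.
  apply: contraR (mulf_neq0 lp0 (_ : 4 != 0)); rewrite ?pnatr_eq0 //.
  by rewrite -leqNgt => h; rewrite -p3 nth_default.
have p'E := @all_roots_prod_XsubC _ p^`() [:: w1; w2; w3] sp' rw.
rewrite uniq_rootsE in p'E; move/(_ uw) in p'E.
have lp' : lead_coef p^`() = lead_coef p * 4 by rewrite /lead_coef sp' p3.
have : p^`().[z1] = lead_coef p * 4 * ((z1 - w1) * (z1 - w2) * (z1 - w3)).
  by rewrite p'E lp' !big_cons big_nil !hornerE /= mulr1 -!mulrA.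
move: pE lp0; move: (lead_coef p) => k -> k0.
rewrite !big_cons big_nil mulr1 derivZ !derivM !derivXsubC !hornerE /=.
rewrite subrr mul0r addr0 => ev; apply: (mulfI k0).
transitivity (- (k * ((z1 - z2) * (z1 - z3) * (z1 - z4)))); first by ring.
by rewrite ev; ring.
Qed.

Lemma cross_gt0_neq {R : rcfType} (b w w' : R[i]) :
  0 < cross w b -> 0 < cross b w' -> w != w'.
Proof.
move=> h; apply: contraTneq => <-; rewrite crossC oppr_gt0 -leNgt; exact: ltW.
Qed.

(** The counterclockwise case of the theorem: the three points lie in
    consecutive cones at [z1], hence are pairwise distinct and make up all the
    roots of [p'], which is incompatible with [mul_neq_in_cyclic_cones]. *)
Lemma not_critical_in_each_triangle {R : realType} (p : {poly R[i]})
  (z1 z2 z3 z4 w1 w2 w3 : R[i]) :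
  size p = 5%N -> uniq [:: z1; z2; z3; z4] ->
  all (root p) [:: z1; z2; z3; z4] ->
  0 < cross (z2 - z1) (z3 - z1) -> 0 < cross (z3 - z1) (z4 - z1) ->
  0 < cross (z4 - z1) (z2 - z1) ->
  plane_interior (triangle z1 z2 z3) w1 ->
  plane_interior (triangle z1 z3 z4) w2 ->
  plane_interior (triangle z1 z4 z2) w3 ->
  ~~ all (root p^`()) [:: w1; w2; w3].
Proof.
move=> sp uz rz ab bc ca /(interior_triangle _ _ _ _ ab)[aw1 w1b].
move=> /(interior_triangle _ _ _ _ bc)[bw2 w2c].
move=> /(interior_triangle _ _ _ _ ca)[cw3 w3a]; apply/negP => rw.
have distinct (b w w' : R[i]) :
    0 < cross (w - z1) b -> 0 < cross b (w' - z1) -> w != w'.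
  move=> /cross_gt0_neq h /h; apply: contra_neq => -> //.
have uw : uniq [:: w1; w2; w3].
  rewrite /= !inE negb_or (distinct _ _ _ w1b bw2) (distinct _ _ _ w2c cw3).
  by rewrite eq_sym (distinct _ _ _ w3a aw1).
apply: (mul_neq_in_cyclic_cones _ _ _ _ _ _ 4 ab bc aw1 w1b bw2 w2c cw3 w3a).
  by rewrite ltr0n.
exact: (deriv_roots_prod p).
Qed.

Theorem theorem2p1 (R : realType) (p : {poly R[i]}) (z1 z2 z3 z4 : R[i])
  (degp : size p = 5%N)
  (distinct_z : uniq [:: z1; z2; z3; z4])
  (zeros_z : all (root p) [:: z1; z2; z3; z4])
  (concave_z : concave_quadrilateral z1 z2 z3 z4) :
  [\/ forall w : R[i], plane_interior (triangle z1 z2 z3) w -> ~~ root p^`() w,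
      forall w : R[i], plane_interior (triangle z1 z3 z4) w -> ~~ root p^`() w
    | forall w : R[i], plane_interior (triangle z1 z4 z2) w -> ~~ root p^`() w].
Proof.
case: concave_z => inner [nd12 nd23 nd31].
have [z21 z31 z41] : [/\ z2 != z1, z3 != z1 & z4 != z1].
  by move: distinct_z; rewrite /= !inE !negb_or ![z1 == _]eq_sym;
    move=> /andP[/and3P[]].
have no_three w1 w2 w3 :
    plane_interior (triangle z1 z2 z3) w1 ->
    plane_interior (triangle z1 z3 z4) w2 ->
    plane_interior (triangle z1 z4 z2) w3 ->
    ~~ all (root p^`()) [:: w1; w2; w3].
  have [[ab bc ca]|[ab bc ca]] := same_orientation _ _ _ _ inner
      (nondegenerate_cross _ _ _ z21 nd12) (nondegenerate_cross _ _ _ z31 nd23)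
      (nondegenerate_cross _ _ _ z41 nd31).
    exact: not_critical_in_each_triangle.
  (* Clockwise case: exchange [z2] and [z3]; the second and third triangles are
     then exchanged as well. *)
  rewrite (triangleAC z1 z2 z3) (triangleAC z1 z3 z4) (triangleAC z1 z4 z2).
  move=> h1 h2 h3.
  rewrite (@perm_all _ [:: w1; w2; w3] [:: w1; w3; w2]); last first.
    by rewrite perm_cons (perm_catC [:: w2] [:: w3]).
  move: ab bc ca; rewrite [cross (z2 - _) _]crossC.
  rewrite [cross (z3 - _) (z4 - _)]crossC.
  rewrite [cross (z4 - _) (z2 - _)]crossC !oppr_lt0 => ba cb ac.
  have swap : perm_eq [:: z1; z2; z3; z4] [:: z1; z3; z2; z4].
    by rewrite perm_cons (perm_catCA [:: z2] [:: z3]).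
  apply: (not_critical_in_each_triangle _ z1 z3 z2 z4) => //.
  - by rewrite -(perm_uniq swap).
  - by rewrite -(perm_all _ swap).
have dichotomy (A : set R[i]) :
    (forall w, plane_interior A w -> ~~ root p^`() w) \/
    exists2 w, plane_interior A w & root p^`() w.
  have [h|h] := pselect (exists2 w, plane_interior A w & root p^`() w).
    by right.
  by left=> w iw; apply/negP => rw; apply: h; exists w.
have [h1|[w1 i1 r1]] := dichotomy (triangle z1 z2 z3); first by constructor 1.
have [h2|[w2 i2 r2]] := dichotomy (triangle z1 z3 z4); first by constructor 2.
constructor 3 => w3 i3.
by have := no_three _ _ _ i1 i2 i3; rewrite /= r1 r2 andbT.
Qed.
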